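(* For each $p\geq1$ there exists $\theta_p>0$ such that for every decreasing, integrable, log-concave function $f:[0,+\infty)\to[0,+\infty)$ and every $h>0$ satisfying $$\int_0^hf(t)\,dt\leq\theta_p\int_0^{+\infty}f(t)\,dt,$$ one has $$\int_0^{+\infty}f(t)^p\,dt\leq\left(\frac1h\int_0^hf(t)\,dt\right)^{p-1}\int_0^{+\infty}f(t)\,dt.$$ Equality holds for $f(t)=c\chi_{[0,d]}(t)$, with $c\geq0$ and $d\geq h$. Moreover, for $p>1$ one may take $$\theta_p=\inf_{x\in(0,1]}\frac1x\,k^{-1}\left(\left[\frac{px}{1-(1-x)^p}\right]^{\frac1{p-1}}\right),$$ where $k(y)=-\frac{\log(1-y)}{y}$ for $y\in(0,1)$.
   Context: ''Decreasing'' means non-increasing. A function $f:[0,+\infty)\to[0,+\infty)$ is log-concave if $f((1-\tau)x+\tau y)\geq f(x)^{1-\tau}f(y)^{\tau}$ for all $x,y\geq 0$ and $\tau\in(0,1)$. $\chi_A$ denotes the indicator function of $A$. The function $k$ is an increasing bijection from $(0,1)$ onto $(1,+\infty)$, and $k^{-1}$ is its inverse. *)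

(* Defs.v *)
From HB Require Import structures.
From mathcomp Require Import all_boot all_order all_algebra.
From mathcomp Require Import all_classical all_reals all_analysis.

Set Implicit Arguments.
Unset Strict Implicit.
Unset Printing Implicit Defensive.

Import Order.TTheory GRing.Theory Num.Theory.
Import numFieldNormedType.Exports.

Local Open Scope classical_set_scope.
Local Open Scope ring_scope.

(* Functions [0, +oo) -> [0, +oo) are represented by functions f : R -> R of
   which only the values on [0, +oo) are constrained or used. *)

Definition log_concave (R : realType) (f : R -> R) : Prop :=
  forall x y tau : R, 0 <= x -> 0 <= y -> 0 < tau < 1 ->
    f x `^ (1 - tau) * f y `^ tau <= f ((1 - tau) * x + tau * y).

Definition decr_log_concave (R : realType) (f : R -> R) : Prop :=
  [/\ forall x, 0 <= x -> 0 <= f x,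
      forall x y, 0 <= x -> x <= y -> f y <= f x,
      (@lebesgue_measure R).-integrable `[0, +oo[ (EFin \o f)
    & log_concave f].

Definition integral_to (R : realType) (f : R -> R) (h : R) : \bar R :=
  (\int[@lebesgue_measure R]_(t in `[0%R, h]) (f t)%:E)%E.

Definition integral_half_line (R : realType) (f : R -> R) : \bar R :=
  (\int[@lebesgue_measure R]_(t in `[0%R, +oo[) (f t)%:E)%E.

Definition mean_to (R : realType) (f : R -> R) (h : R) : \bar R :=
  ((h^-1)%:E * integral_to f h)%E.

(* In the bound below, 0 to the power 0 is 1 (relevant only for p = 1). *)
Definition power_mean_bound (R : realType) (p : R) (f : R -> R) (h : R)
    : \bar R :=
  (mean_to f h `^ (p - 1) * integral_half_line f)%E.

Definition admissible (R : realType) (p theta : R) : Prop :=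
  forall (f : R -> R) (h : R), decr_log_concave f -> 0 < h ->
    (integral_to f h <= theta%:E * integral_half_line f)%E ->
    (integral_half_line (fun t => (f t `^ p)%R) <= power_mean_bound p f h)%E.

Definition k (R : realType) (y : R) : R := - (ln (1 - y) / y).

(* Inverse of the bijection k : (0, 1) -> (1, +oo); the default value 0 is
   taken only outside k @` `]0, 1[ = `]1, +oo[. *)
Definition k_inv (R : realType) : R -> R := 'pinv_(fun=> 0) `]0, 1[ (@k R).

Definition theta_const (R : realType) (p : R) : R :=
  inf [set x^-1 * k_inv ((p * x / (1 - (1 - x) `^ p)) `^ (p - 1)^-1)
      | x in `]0, 1] ].

(* Main.v *)
Require Import Defs.
From HB Require Import structures.
From mathcomp Require Import all_boot all_order all_algebra.
From mathcomp Require Import all_classical all_reals all_analysis.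
From mathcomp Require Import measurable_realfun ring lra.

(** The proof replaces f by a truncated exponential, for which the inequality
    is an explicit statement about k.

    Let p > 1 and suppose that 0 < f h and that f h is below the mean of f on
    [0, h]. Choose the exponential g(t) = c exp(- a t) with g h = f h and with
    the same integral as f over [0, h]. As ln f is concave and ln g is affine,
    on [0, h] the function g is above f up to a crossing point and below f from
    there on, and after h it is above f again ([tail_le_expfun]). Now cut g at
    the height m for which the cut function has the same integral as f over
    [h, +oo[. On each of the two pieces the new function has the mass of f, but
    more concentrated on large values, so the convexity of u^p makes its power
    integral larger ([head_power_le], [tail_power_le]). Both comparisons are
    obtained by integrating a pointwise inequality f^p + l g <= g^p + l f,
    where the multiplier l is fixed by the value at the crossing or at the cut
    ([integral_exchange_le]).

    For the truncated exponential let x and y be the proportions of height lost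
    at the cut and at h, so that m = c (1 - x) and f h = c (1 - y). The
    integrals of the cut function over the half-line and over [0, h] are c x/a
    and c y/a, its mean on [0, h] is c / k y, and its power integral is
    c^p (1 - (1 - x)^p) / (a p). The hypothesis reads y <= theta x and the claim
    reads k y <= (p x / (1 - (1 - x)^p))^(1/(p-1)), so the infimum defining
    theta_const p is exactly what makes the first imply the second
    ([theta_const_ratio]).

    That theta_const p is positive comes from k y < 1/(1 - y): it is enough
    that 1 - (1 - x)^p <= p x (1 - theta x)^(p-1) on ]0, 1] for some
    theta > 0, and Bernoulli's inequalities provide one
    ([one_sub_powR_le_theta_floor]). If f h equals the mean of f on [0, h],
    then f is bounded by that mean on ]0, +oo[ and the inequality is immediate.
    If f h = 0, all the mass of f lies in [0, h], and since theta_const p < 1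
    the hypothesis forces f to vanish on ]0, +oo[. For p = 1 the inequality is
    an equality. *)

Set Implicit Arguments.
Unset Strict Implicit.
Unset Printing Implicit Defensive.

Import Order.TTheory GRing.Theory Num.Theory.
Import numFieldNormedType.Exports.

Local Open Scope classical_set_scope.
Local Open Scope ring_scope.

Local Notation mu := lebesgue_measure.

(** * Bernoulli inequalities for real powers *)

Lemma bernoulli_le1 (R : realType) (u s : R) :
  0 <= u -> 0 < s -> s <= 1 -> u `^ s <= 1 + s * (u - 1).
Proof.
move=> u0 s0; rewrite le_eqVlt => /predU1P[->|s1].
  by rewrite powRr1 //; lra.
(* Young's inequality for u^s and 1 with exponents 1/s and 1/(1 - s). *)
have r0 : 0 < 1 - s by lra.
have := @conjugate_powR R (u `^ s) 1 s^-1 (1 - s)^-1 (powR_ge0 _ _) ler01.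
rewrite !invr_gt0 !invrK s0 r0 => /(_ isT isT) /(_ ltac:(lra)).
rewrite powR1 mulr1 -powRrM divff ?gt_eqF // powRr1 //; lra.
Qed.

(** Follows from the concave case applied to u^s with exponent 1/s. *)
Lemma bernoulli_ge1 (R : realType) (u s : R) :
  0 <= u -> 1 <= s -> 1 + s * (u - 1) <= u `^ s.
Proof.
move=> u0 s1; have s0 : 0 < s by lra.
have := @bernoulli_le1 R (u `^ s) s^-1 (powR_ge0 _ _).
rewrite invr_gt0 invf_le1 // -powRrM divff ?gt_eqF // powRr1 // => /(_ s0 s1).
rewrite -lerBlDl mulrC ler_pdivlMr //; lra.
Qed.

(** The graph of u^p lies above its tangent at w, by homogeneity from the
    tangent at 1. *)
Lemma powR_tangent (R : realType) (p u w : R) : 1 < p -> 0 <= u -> 0 <= w ->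
  w `^ p + p * w `^ (p - 1) * (u - w) <= u `^ p.
Proof.
move=> p1 u0; rewrite le_eqVlt => /predU1P[<-|w0].
  by rewrite !powR0 ?mulr0 ?mul0r ?addr0 ?powR_ge0 // gt_eqF; lra.
have -> : u `^ p = w `^ p * (u / w) `^ p.
  by rewrite -powRM ?divr_ge0 ?(ltW w0) // mulrC divfK // gt_eqF.
have /(ler_wpM2l (powR_ge0 w p)) : 1 + p * (u / w - 1) <= (u / w) `^ p.
  by apply: bernoulli_ge1; rewrite ?divr_ge0 ?(ltW w0) ?(ltW p1).
apply: le_trans; rewrite le_eqVlt; apply/orP; left; apply/eqP.
rewrite -(@mulr_powRB1 _ w p) ?(ltW w0) //; last by lra.
by field; rewrite gt_eqF.
Qed.

(** The left-hand side is p times the integral of s^(p-1) over [1 - x, 1];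
    the bound replaces the integrand by its supremum on each half of that
    interval. *)
Lemma one_sub_powR_le (R : realType) (p x : R) : 1 < p -> 0 < x -> x <= 1 ->
  1 - (1 - x) `^ p <= p * x * ((1 + (1 - x / 2) `^ (p - 1)) / 2).
Proof.
move=> p1 x0 x1.
(* Tangent of u^p at the midpoint 1 - x/2, evaluated at 1 - x, then
   Bernoulli at the midpoint. *)
have /= := @powR_tangent R p (1 - x) (1 - x / 2) p1 ltac:(lra) ltac:(lra).
have /= := @bernoulli_ge1 R (1 - x / 2) p ltac:(lra) (ltW p1).
set W := _ `^ (p - 1); set A := _ `^ p; set B := _ `^ p; nra.
Qed.

(** An explicit positive lower bound for the constant theta_const p. *)
Definition theta_floor (R : realType) (p : R) : R :=
  Num.min (p - 1) 1 / (4 * Num.max (p - 1) 1).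

Lemma theta_floor_bounds (R : realType) (p : R) : 1 < p ->
  0 < theta_floor p <= 4^-1.
Proof.
move=> p1; rewrite /theta_floor; have q0 : 0 < p - 1 by lra.
have [q1|q1] := leP (p - 1) 1.
  by rewrite mulr1; apply/andP; split; lra.
have q2 : 0 < 4 * (p - 1) by lra.
by rewrite mul1r invr_gt0 q2 /= lef_pV2 ?posrE //; lra.
Qed.

(** Both 1 - (1 - x/2)^(p-1) and 1 - (1 - theta x)^(p-1) are of order x. By
    Bernoulli, half of the first is at least min(p-1, 1) x/4 and the second is
    at most max(p-1, 1) theta x, and theta_floor p makes these bounds equal. *)
Lemma one_sub_powR_le_theta_floor (R : realType) (p x : R) :
  1 < p -> 0 < x -> x <= 1 ->
  1 - (1 - x) `^ p <= p * x * (1 - theta_floor p * x) `^ (p - 1).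
Proof.
move=> p1 x0 x1; have /andP[t0 t1] := @theta_floor_bounds R p p1.
apply: (le_trans (one_sub_powR_le p1 x0 x1)).
rewrite ler_pM2l; last by rewrite mulr_gt0 //; lra.
have t1x : 0 < 1 - theta_floor p * x by nra.
have [q1|q1] := leP (p - 1) 1.
  have H1 := @bernoulli_le1 R (1 - x / 2) (p - 1) ltac:(lra) ltac:(lra) q1.
  have H2 : 1 - theta_floor p * x <= (1 - theta_floor p * x) `^ (p - 1).
    by apply: ger1_powR => //; rewrite t1x /=; nra.
  apply: le_trans H2; move: H1.
  rewrite /theta_floor min_l // max_r // mulr1.
  set W := _ `^ _; move=> ?; lra.
have H1 : (1 - x / 2) `^ (p - 1) <= 1 - x / 2.
  by apply: ge1r_powR; [apply/andP; split|]; lra.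
have := @bernoulli_ge1 R (1 - theta_floor p * x) (p - 1) (ltW t1x) (ltW q1).
apply: le_trans.
have -> : theta_floor p = (4 * (p - 1))^-1.
  by rewrite /theta_floor min_r ?(ltW q1) // max_l ?mul1r // ltW.
have -> : 1 + (p - 1) * (1 - (4 * (p - 1))^-1 * x - 1) = 1 - x / 4.
  by field; rewrite gt_eqF; lra.
lra.
Qed.

(** * The function k and its inverse *)

Lemma k_gt0 (R : realType) (y : R) : 0 < y -> y < 1 -> 0 < k y.
Proof.
move=> y0 y1; rewrite /k -mulNr divr_gt0 // oppr_gt0.
by apply: ln_lt0; apply/andP; split; lra.
Qed.

(** This is the strict inequality ln w < w - 1 at w = 1/(1 - y). *)
Lemma k_lt (R : realType) (y : R) : 0 < y -> y < 1 -> k y < (1 - y)^-1.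
Proof.
move=> y0 y1; rewrite /k -mulNr ltr_pdivrMr // -lnV ?posrE; last lra.
have z0 : 0 < (1 - y)^-1 by rewrite invr_gt0; lra.
have := @expR_gt1Dx R (ln (1 - y)^-1).
rewrite lnK ?posrE // gt_eqF; last first.
  by rewrite ln_gt0 // invf_gt1; lra.
move=> /(_ isT); have -> : (1 - y)^-1 * y = (1 - y)^-1 - 1.
  by field; rewrite gt_eqF; lra.
lra.
Qed.

(** The slopes of the convex function - ln (1 - y) from the origin increase;
    convexity enters as Bernoulli's inequality for (1 - z)^(y/z). *)
Lemma k_nondecreasing (R : realType) (y z : R) :
  0 < y -> y <= z -> z < 1 -> k y <= k z.
Proof.
move=> y0 yz z1; have z0 : 0 < z by lra.
have lem : y / z * ln (1 - z) <= ln (1 - y).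
  rewrite -ln_powR ler_ln ?posrE ?powR_gt0 //; try lra.
  have -> : 1 - y = 1 + y / z * (1 - z - 1).
    by field; rewrite gt_eqF.
  by apply: bernoulli_le1; rewrite ?divr_gt0 ?ler_pdivrMr ?mul1r //; lra.
by rewrite /k lerN2 ler_pdivlMr // mulrAC (mulrC _ y) mulrAC.
Qed.

(** Intermediate value theorem between z = ln v and z = v. *)
Lemma k_surj (R : realType) (v : R) : 1 < v ->
  exists y : R, [/\ 0 < y, y < 1 & k y = v].
Proof.
move=> v1.
(* With y = 1 - exp (- z), the equation k y = v reads z + v exp (- z) = v. *)
pose g z : R := z + v * expR (- z).
have cg : continuous g.
  move=> z; apply: cvgD; first exact: cvg_id.
  apply: cvgM; first exact: cvg_cst.
  apply: (@continuous_comp _ _ _ (fun x : R => - x) expR).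
    exact: opp_continuous.
  exact: continuous_expR.
have lv0 : 0 < ln v by rewrite ln_gt0.
have v0 : v \is Num.pos by rewrite posrE; lra.
have lvv : ln v + 1 < v.
  by have := @expR_gt1Dx R (ln v); rewrite lnK // gt_eqF // addrC => /(_ isT).
have gl : g (ln v) = ln v + 1.
  by rewrite /g expRN lnK // divff // gt_eqF //; lra.
have gv : v < g v by rewrite /g ltrDl mulr_gt0 ?expR_gt0 //; lra.
have [] := @IVT R g (ln v) v v.
- lra.
- by apply: continuous_subspaceT => z; exact: cg.
- by rewrite gl min_l ?max_r ?(ltW gv) ?(ltW lvv) //; lra.
move=> z; rewrite in_itv /= => /andP[z1 z2] gz.
have ez : expR (- z) < 1 by rewrite expR_lt1; lra.
have ez0 := expR_gt0 (- z).
exists (1 - expR (- z)); split; [lra|lra|].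
rewrite /k opprB addrCA subrr addr0 expRK mulNr opprK.
apply: (canLR (mulfK _)); first by rewrite gt_eqF //; lra.
by rewrite /g in gz; lra.
Qed.

(** k_inv v is a preimage of v because k is onto ]1, +oo[. *)
Lemma k_invP (R : realType) (v : R) : 1 < v ->
  [/\ 0 < k_inv v, k_inv v < 1 & k (k_inv v) = v].
Proof.
move=> /k_surj[y [y0 y1 kyv]].
have vI : [set k x | x in `]0, 1[%classic] v.
  by exists y => //=; rewrite in_itv /= y0.
have kI : k (k_inv v) = v by rewrite /k_inv pinvK // inE.
have : `]0, 1[%classic (k_inv v).
  apply: (@surjpinv_image_sub _ _ (fun=> 0) `]0, 1[%classic _ (@k R)
    (@subset_refl _ _)).
  by exists v.
by rewrite /= in_itv /= => /andP[].
Qed.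

(** * The constant theta *)

(** The argument of k_inv in theta_const. For the exponential c exp(- a t)
    cut where it has lost a proportion x of its height, the power p - 1 of
    ratio_root p x is c^(p-1) times the ratio of the integral of the function
    to that of its p-th power. *)
Definition ratio_root (R : realType) (p x : R) : R :=
  (p * x / (1 - (1 - x) `^ p)) `^ (p - 1)^-1.

Lemma powR_1B_lt1 (R : realType) (p x : R) :
  1 < p -> 0 < x -> x <= 1 -> (1 - x) `^ p < 1.
Proof.
move=> p1 x0 x1; have {2}<- : 1 `^ p = 1 :> R by rewrite powR1.
by apply: gt0_ltr_powR; rewrite ?nnegrE; lra.
Qed.

(** The right-hand side of one_sub_powR_le_theta_floor, solved for the
    ratio. *)
Lemma ratio_root_ge (R : realType) (p x : R) :
  1 < p -> 0 < x -> x <= 1 -> (1 - theta_floor p * x)^-1 <= ratio_root p x.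
Proof.
move=> p1 x0 x1; have D0 := powR_1B_lt1 p1 x0 x1.
have /andP[t0 t1] := theta_floor_bounds p1.
have w0 : 0 < 1 - theta_floor p * x by nra.
have q0 : 0 < p - 1 by lra.
have -> : (1 - theta_floor p * x)^-1
    = ((1 - theta_floor p * x)^-1 `^ (p - 1)) `^ (p - 1)^-1.
  by rewrite -powRrM divff ?gt_eqF // powRr1 // invr_ge0 ltW.
apply: ge0_ler_powR; rewrite ?nnegrE ?invr_ge0 ?powR_ge0 ?(ltW q0) //.
  by rewrite divr_ge0 ?mulr_ge0 //; lra.
rewrite ler_pdivlMr; last lra.
rewrite -powR_inv1 ?(ltW w0) // powRAC powR_inv1 ?powR_ge0 //.
by rewrite ler_pdivrMl ?powR_gt0 // mulrC one_sub_powR_le_theta_floor.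
Qed.

Lemma ratio_root_gt1 (R : realType) (p x : R) :
  1 < p -> 0 < x -> x <= 1 -> 1 < ratio_root p x.
Proof.
move=> p1 x0 x1; apply: lt_le_trans (ratio_root_ge p1 x0 x1).
have /andP[t0 t1] := theta_floor_bounds p1.
by rewrite invf_gt1 //; nra.
Qed.

(** By k_lt and ratio_root_ge, k (theta_floor p * x) < ratio_root p x, and k is
    monotone. *)
Lemma k_inv_ratio_root_ge (R : realType) (p x : R) :
  1 < p -> 0 < x -> x <= 1 -> theta_floor p * x <= k_inv (ratio_root p x).
Proof.
move=> p1 x0 x1; have /andP[t0 t1] := theta_floor_bounds p1.
have [y0 y1 kyv] := k_invP (ratio_root_gt1 p1 x0 x1).
have tx0 : 0 < theta_floor p * x by rewrite mulr_gt0.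
have tx1 : theta_floor p * x < 1 by nra.
rewrite leNgt; apply/negP => lt_inv.
have := k_nondecreasing y0 (ltW lt_inv) tx1.
rewrite kyv leNgt => /negP; apply.
exact: lt_le_trans (k_lt tx0 tx1) (ratio_root_ge p1 x0 x1).
Qed.

Lemma theta_const_gt0 (R : realType) (p : R) : 1 < p -> 0 < theta_const p.
Proof.
move=> p1; have /andP[t0 _] := theta_floor_bounds p1.
apply: (lt_le_trans t0); apply: lb_le_inf.
  by eexists; exists 1 => /=; [rewrite in_itv /= ltr01 lexx|reflexivity].
move=> _ [x + <-]; rewrite /= in_itv /= => /andP[x0 x1].
by rewrite ler_pdivlMl // mulrC; exact: k_inv_ratio_root_ge.
Qed.

Lemma theta_const_le (R : realType) (p x : R) : 1 < p -> 0 < x -> x <= 1 ->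
  theta_const p * x <= k_inv (ratio_root p x).
Proof.
move=> p1 x0 x1; rewrite mulrC -ler_pdivlMl //; apply: ge_inf.
  exists 0 => _ [z + <-]; rewrite /= in_itv /= => /andP[z0 z1].
  have [/ltW y0 _ _] := k_invP (ratio_root_gt1 p1 z0 z1).
  by rewrite mulr_ge0 // invr_ge0 ltW.
by exists x => //=; rewrite in_itv /= x0.
Qed.

(** Values of k_inv lie in ]0, 1[, and x = 1 is one of the points of the
    infimum. *)
Lemma theta_const_lt1 (R : realType) (p : R) : 1 < p -> theta_const p < 1.
Proof.
move=> p1; have := theta_const_le p1 ltr01 (lexx 1); rewrite mulr1.
move=> /le_lt_trans; apply.
by have [] := k_invP (ratio_root_gt1 p1 ltr01 (lexx 1)).
Qed.

(** This is the power mean inequality for truncated exponentials, x and y being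
    the proportions of height lost at the cut and at h. *)
Lemma theta_const_ratio (R : realType) (p x y : R) :
  1 < p -> 0 < x -> x <= 1 -> 0 < y -> y <= theta_const p * x ->
  k y `^ (p - 1) * (1 - (1 - x) `^ p) <= p * x.
Proof.
move=> p1 x0 x1 y0 yx; have D0 := powR_1B_lt1 p1 x0 x1.
have [v0 v1 kv] := k_invP (ratio_root_gt1 p1 x0 x1).
have yv := le_trans yx (theta_const_le p1 x0 x1).
have kyv := k_nondecreasing y0 yv v1.
have q0 : 0 < p - 1 by lra.
have k0 := k_gt0 y0 (le_lt_trans yv v1).
rewrite -ler_pdivlMr; last lra.
have -> : p * x / (1 - (1 - x) `^ p) = ratio_root p x `^ (p - 1).
  rewrite -powRrM mulVf ?gt_eqF // powRr1 // divr_ge0 ?mulr_ge0 //; lra.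
rewrite kv in kyv; apply: ge0_ler_powR => //; rewrite ?nnegrE ltW //.
exact: lt_le_trans kyv.
Qed.

(** * Exponentials and truncated exponentials *)

Definition expfun (R : realType) (c a t : R) : R := c * expR (- (a * t)).

Lemma expfun_gt0 (R : realType) (c a t : R) : 0 < c -> 0 < expfun c a t.
Proof. by move=> c0; rewrite mulr_gt0 // expR_gt0. Qed.

Lemma expfun_powR (R : realType) (c a t s : R) : 0 < c ->
  expfun c a t `^ s = expfun (c `^ s) (a * s) t.
Proof.
move=> c0; rewrite /expfun powRM ?expR_ge0 ?(ltW c0) // -expRM.
by congr (_ * expR _); ring.
Qed.

Lemma expfun_lt (R : realType) (c a s t : R) : 0 < c -> 0 < a ->
  (expfun c a s < expfun c a t) = (t < s).
Proof. by move=> c0 a0; rewrite ltr_pM2l // ltr_expR ltrN2 ltr_pM2l. Qed.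

Lemma expfun_le (R : realType) (c a s t : R) : 0 < c -> 0 < a ->
  (expfun c a s <= expfun c a t) = (t <= s).
Proof. by move=> c0 a0; rewrite leNgt expfun_lt // -leNgt. Qed.

(** Equality in the definition of log-concavity: exponentials are the
    log-affine functions. *)
Lemma expfun_geomean (R : realType) (c a x y tau : R) : 0 < c ->
  expfun c a x `^ (1 - tau) * expfun c a y `^ tau
    = expfun c a ((1 - tau) * x + tau * y).
Proof.
move=> c0; rewrite !expfun_powR // /expfun mulrACA -expRD.
rewrite -powRD ?subrK ?powRr1 ?(ltW c0) ?gt_eqF ?implybT //.
by congr (_ * expR _); ring.
Qed.

Lemma is_derive_expfun (R : realType) (c a t : R) : a != 0 ->
  is_derive t 1 (expfun (- (c / a)) a) (expfun c a t).
Proof.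
move=> a0; apply: is_derive_eq; rewrite /expfun.
by rewrite /GRing.scale /=; field.
Qed.

Lemma continuous_expfun (R : realType) (c a : R) : continuous (expfun c a).
Proof.
move=> t; apply/differentiable_continuous/derivable1_diffP.
by rewrite /expfun; apply: ex_derive.
Qed.

Lemma measurable_expfun (R : realType) (c a : R) (D : set R) :
  measurable D -> measurable_fun D (expfun c a).
Proof.
move=> mD; apply: measurable_funTS.
by apply: continuous_measurable_fun; exact: continuous_expfun.
Qed.

Lemma integral_expfun (R : realType) (c a u v : R) : a != 0 -> u <= v ->
  (\int[lebesgue_measure]_(t in `[u, v]) (expfun c a t)%:E)%E
    = ((expfun c a u - expfun c a v) / a)%:E.
Proof.
move=> a0; rewrite le_eqVlt => /predU1P[<-|uv].
  by rewrite set_itv1 integral_set1 subrr mul0r.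
rewrite (@continuous_FTC2 _ _ (expfun (- (c / a)) a)) //.
- by rewrite -EFinB /expfun; congr _%:E; field.
- by apply: continuous_subspaceT => t; exact: continuous_expfun.
- split.
  + by move=> t _; case: (is_derive_expfun c t a0).
  + by apply: cvg_at_right_filter; exact: continuous_expfun.
  + by apply: cvg_at_left_filter; exact: continuous_expfun.
- by move=> t _; rewrite derive1E; case: (is_derive_expfun c t a0).
Qed.

Lemma integral_expfuny (R : realType) (c a u : R) : 0 <= c -> 0 < a ->
  (\int[lebesgue_measure]_(t in `[u, +oo[) (expfun c a t)%:E)%E
    = (expfun c a u / a)%:E.
Proof.
move=> c0 a0; have an0 : a != 0 by rewrite gt_eqF.
rewrite (@ge0_continuous_FTC2y _ _ (expfun (- (c / a)) a) _ 0) //.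
- by rewrite -EFinB /expfun; congr _%:E; field.
- by move=> t _; rewrite mulr_ge0 // expR_ge0.
- by apply: continuous_subspaceT => t; exact: continuous_expfun.
- rewrite -(mulr0 (- (c / a))); apply: cvgM; first exact: cvg_cst.
  apply: (@cvg_comp _ _ _ (fun z => a * z) (fun z => expR (- z)) _
           (pinfty_nbhs R)); last exact: cvgr_expR.
  exact: gt0_cvgMry.
- by apply: cvg_at_right_filter; exact: continuous_expfun.
- by move=> t _; rewrite derive1E; case: (is_derive_expfun c t an0).
Qed.

(** Cutting by height rather than by abscissa lets m = 0 stand for the whole
    exponential, so that the untruncated case is not separate. *)
Definition trunc_expfun (R : realType) (m c a t : R) : R :=
  if m <= expfun c a t then expfun c a t else 0.

(** Powers of truncated exponentials are truncated exponentials, so a single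
    integral formula serves for the function and its power. *)
Lemma trunc_expfun_powR (R : realType) (m c a t s : R) :
  0 < s -> 0 < c -> 0 <= m ->
  trunc_expfun m c a t `^ s = trunc_expfun (m `^ s) (c `^ s) (a * s) t.
Proof.
move=> s0 c0 m0; rewrite /trunc_expfun -expfun_powR //.
have g0 := ltW (expfun_gt0 a t c0).
have [mg|gm] := leP m (expfun c a t).
  by rewrite ifT // ge0_ler_powR ?nnegrE // ltW.
rewrite ifF ?powR0 ?gt_eqF //; apply/negbTE; rewrite -ltNge.
exact: gt0_ltr_powR.
Qed.

Lemma measurable_trunc_expfun (R : realType) (m c a : R) (D : set R) :
  measurable D -> measurable_fun D (trunc_expfun m c a).
Proof.
move=> mD; apply: measurable_funTS; apply: measurable_fun_ifT.
- apply: measurable_fun_ler; first exact: measurable_cst.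
  exact: measurable_expfun.
- exact: measurable_expfun.
- exact: measurable_cst.
Qed.

Lemma integral_trunc_expfun (R : realType) (m c a u : R) :
  0 < c -> 0 < a -> 0 <= m -> m <= expfun c a u ->
  (\int[lebesgue_measure]_(t in `[u, +oo[) (trunc_expfun m c a t)%:E)%E
    = ((expfun c a u - m) / a)%:E.
Proof.
move=> c0 a0; rewrite le_eqVlt => /predU1P[<- _|m0 mu].
  rewrite subr0 -integral_expfuny ?ltW //; apply: eq_integral => t _.
  by rewrite /trunc_expfun ltW // expfun_gt0.
(* The exponential reaches height m at d. *)
pose d := - (ln (m / c) / a).
have gd : expfun c a d = m.
  rewrite /expfun /d mulrN opprK mulrC (mulrC a) divfK ?gt_eqF //.
  by rewrite lnK ?divfK ?gt_eqF // posrE divr_gt0.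
have ud : u <= d by rewrite -(expfun_le _ _ c0 a0) gd.
rewrite -[in RHS]gd -integral_expfun ?gt_eqF //.
have -> : `[u, d]%classic = `[u, +oo[%classic `&` `]-oo, d]%classic.
  by apply/seteqP; split=> t /=; rewrite !in_itv /= ?andbT => /andP.
rewrite integral_mkcondr; apply: eq_integral => t _.
rewrite /patch /trunc_expfun -gd expfun_le //.
by have [td|td] := leP t d; [rewrite mem_set|rewrite memNset] => //=;
  rewrite in_itv /= ?td // leNgt td.
Qed.

(** * Comparison of integrals *)

Lemma measurable_fun_powR (R : realType) (g : R -> R) (D : set R) (p : R) :
  measurable_fun D g -> measurable_fun D (fun t => g t `^ p).
Proof.
move=> mg; exact: (@measurableT_comp _ _ _ _ _ _ (@powR R ^~ p)).
Qed.

(** How a pointwise comparison with a multiplier l becomes a comparison of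
    integrals: when f and g have the same integral, the terms in l cancel. It
    is stated with sums of nonnegative functions so that F and G may have
    infinite integral. *)
Lemma integral_exchange_le d (T : measurableType d) (R : realType)
    (mu : {measure set T -> \bar R}) (D : set T) (f g F G : T -> R) (l B : R) :
  measurable D -> 0 <= l ->
  measurable_fun D f -> measurable_fun D g ->
  measurable_fun D F -> measurable_fun D G ->
  (forall t, D t -> [/\ 0 <= f t, 0 <= g t, 0 <= F t & 0 <= G t]) ->
  (forall t, D t -> F t + l * g t <= G t + l * f t) ->
  (\int[mu]_(t in D) (f t)%:E = B%:E)%E ->
  (\int[mu]_(t in D) (g t)%:E = B%:E)%E ->
  (\int[mu]_(t in D) (F t)%:E <= \int[mu]_(t in D) (G t)%:E)%E.
Proof.
move=> mD l0 mf mg mF mG ge0 le_pt fB gB.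
have sum (u v : T -> R) : measurable_fun D u -> measurable_fun D v ->
    (forall t, D t -> 0 <= u t) -> (forall t, D t -> 0 <= v t) ->
    (\int[mu]_(t in D) (u t + l * v t)%:E
      = \int[mu]_(t in D) (u t)%:E + l%:E * \int[mu]_(t in D) (v t)%:E)%E.
  move=> mu' mv u0 v0.
  under eq_integral do rewrite EFinD EFinM.
  rewrite ge0_integralD //.
  - by rewrite ge0_integralZl //; exact/measurable_EFinP.
  - exact/measurable_EFinP.
  - by move=> t Dt; rewrite mule_ge0 // lee_fin // v0.
  - by apply: measurable_funeM; exact/measurable_EFinP.
have F0 t : D t -> 0 <= F t by move=> /ge0[].
have G0 t : D t -> 0 <= G t by move=> /ge0[].
have f0 t : D t -> 0 <= f t by move=> /ge0[].
have g0 t : D t -> 0 <= g t by move=> /ge0[].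
have := sum _ _ mG mf G0 f0; have := sum _ _ mF mg F0 g0.
rewrite fB gB => sumF sumG.
rewrite -(@leeD2rE _ (l%:E * B%:E)%E) // -sumF -sumG.
apply: ge0_le_integral => //.
- by move=> t Dt; rewrite lee_fin addr_ge0 ?mulr_ge0 ?F0 ?g0.
- by apply/measurable_EFinP; apply: measurable_funD => //;
  exact: measurable_funM.
- by apply/measurable_EFinP; apply: measurable_funD => //;
  exact: measurable_funM.
Qed.

(** g - f is nonnegative with integral zero, hence vanishes almost
    everywhere. *)
Lemma measure0_lt_of_eq_integral d (T : measurableType d) (R : realType)
    (mu : {measure set T -> \bar R}) (D A : set T) (f g : T -> R) :
  measurable D -> measurable A -> A `<=` D ->
  mu.-integrable D (EFin \o f) -> mu.-integrable D (EFin \o g) ->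
  (forall t, D t -> f t <= g t) -> (forall t, A t -> f t < g t) ->
  (\int[mu]_(t in D) (f t)%:E = \int[mu]_(t in D) (g t)%:E)%E -> mu A = 0%E.
Proof.
move=> mD mA AD intf intg le_fg lt_fg fgE.
have int0 : (\int[mu]_(t in D) `|(g t)%:E - (f t)%:E| = 0)%E.
  under eq_integral => t tD.
    have H : (`|(g t)%:E - (f t)%:E| = (g t)%:E - (f t)%:E)%E.
      by rewrite gee0_abs // sube_ge0 // lee_fin le_fg //; exact: set_mem.
    rewrite H; over.
  rewrite integralB_EFin // fgE subee // integrable_fin_num //.
move/ae_eq_integral_abs : int0 => /(_ mD).
have mfg : measurable_fun D (fun t => (g t)%:E - (f t)%:E)%E.
  by apply: emeasurable_funB; [case/integrableP : intg|case/integrableP : intf].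
move=> /(_ mfg) ae0.
have : mu.-negligible A.
  apply: negligibleS ae0 => t At /= /(_ (AD _ At)) /eqP.
  by rewrite -EFinB eqe subr_eq0 gt_eqF // lt_fg.
by move=> /negligibleP; exact.
Qed.

(** * Log-concave functions against exponentials *)

(** Intermediate value theorem for exp z - r z between ln r, where it is at
    most 1, and 4 r, where exp (4 r) >= (1 + 2 r)^2 makes it at least 1. *)
Lemma expR_secant_surj (R : realType) (r : R) : 1 < r ->
  exists2 z : R, 0 < z & expR z = 1 + r * z.
Proof.
move=> r1; pose g z : R := expR z - r * z.
have cg : continuous g.
  move=> z; apply: cvgB; first exact: continuous_expR.
  by apply: cvgM; [exact: cvg_cst|exact: cvg_id].
have lr0 : 0 < ln r by rewrite ln_gt0.
have rpos : r \is Num.pos by rewrite posrE; lra.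
have lr : ln r < r by apply: ln_sublinear; lra.
have g1 : g (ln r) <= 1.
  rewrite /g lnK //; have := @expR_ge1Dx R (- ln r).
  rewrite expRN lnK // => H.
  have : r * (1 - ln r) <= r * r^-1 by rewrite ler_pM2l //; lra.
  by rewrite divff ?gt_eqF //; lra.
have g2 : 1 <= g (4 * r).
  rewrite /g (_ : 4 * r = 2 * r + 2 * r); last ring.
  rewrite expRD; have := @expR_ge1Dx R (2 * r).
  set E := expR _ => H; nra.
have [] := @IVT R g (ln r) (4 * r) 1.
- lra.
- by apply: continuous_subspaceT => z; exact: cg.
- by rewrite min_l ?max_r ?g1 ?g2 // (le_trans g1 g2).
move=> z; rewrite in_itv /= => /andP[z1 _] gz.
by exists z; [lra|rewrite /g in gz; lra].
Qed.

Lemma between_conv (R : realType) (s t u : R) : s < t -> t < u ->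
  exists2 tau : R, 0 < tau < 1 & t = (1 - tau) * s + tau * u.
Proof.
move=> st tu; have us : 0 < u - s by lra.
exists ((t - s) / (u - s)); last by field; rewrite gt_eqF.
by rewrite divr_gt0 ?ltr_pdivrMr ?mul1r //=; lra.
Qed.

(** A log-concave function that is above an exponential at two points is above
    it in between: the exponential is log-affine. *)
Lemma log_concave_crossing_lt (R : realType) (f : R -> R) (c a s t u : R) :
  log_concave f -> 0 < c -> 0 <= s -> s < t -> t < u ->
  expfun c a s <= f s -> expfun c a u < f u -> expfun c a t < f t.
Proof.
move=> lcf c0 s0 st tu gs gu.
have [tau tau01 tE] := between_conv st tu.
have u0 : 0 <= u by lra.
have := lcf s u tau s0 u0 tau01; rewrite -tE; apply: lt_le_trans.
rewrite {1}tE -expfun_geomean //.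
have gs0 := expfun_gt0 a s c0; have gu0 := expfun_gt0 a u c0.
have /andP[tau0 tau1] := tau01.
apply: (@le_lt_trans _ _ (f s `^ (1 - tau) * expfun c a u `^ tau)).
  rewrite ler_wpM2r ?powR_ge0 // ge0_ler_powR ?nnegrE //; lra.
rewrite ltr_pM2l ?powR_gt0 //; last lra.
by rewrite gt0_ltr_powR ?nnegrE //; lra.
Qed.

Lemma log_concave_crossing_le (R : realType) (f : R -> R) (c a s t u : R) :
  log_concave f -> 0 < c -> 0 <= s -> s <= t -> t <= u ->
  expfun c a s <= f s -> expfun c a u <= f u -> expfun c a t <= f t.
Proof.
move=> lcf c0 s0; rewrite le_eqVlt => /predU1P[<-//|st].
rewrite le_eqVlt => /predU1P[->//|tu] gs gu.
have [tau tau01 tE] := between_conv st tu.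
have u0 : 0 <= u by lra.
have := lcf s u tau s0 u0 tau01; rewrite -tE; apply: le_trans.
rewrite {1}tE -expfun_geomean //.
have gs0 := expfun_gt0 a s c0; have gu0 := expfun_gt0 a u c0.
have /andP[tau0 tau1] := tau01.
by apply: ler_pM; rewrite ?powR_ge0 // ge0_ler_powR ?nnegrE //; lra.
Qed.

Lemma decr_log_concave_integrable (R : realType) (f : R -> R) (D : set R) :
  decr_log_concave f -> measurable D -> D `<=` `[0, +oo[ ->
  mu.-integrable D (EFin \o f).
Proof. by move=> [_ _ intf _] mD D0; exact: integrableS intf. Qed.

Lemma decr_log_concave_measurable (R : realType) (f : R -> R) (D : set R) :
  decr_log_concave f -> measurable D -> D `<=` `[0, +oo[ ->
  measurable_fun D f.
Proof.
move=> df mD D0; apply/measurable_EFinP.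
exact: measurable_int (decr_log_concave_integrable df mD D0).
Qed.

Lemma decr_log_concave_powR_measurable (R : realType) (f : R -> R) (D : set R)
    (p : R) :
  decr_log_concave f -> measurable D -> D `<=` `[0, +oo[ ->
  measurable_fun D (fun t => f t `^ p).
Proof.
move=> df mD D0; apply: measurable_fun_powR.
exact: decr_log_concave_measurable.
Qed.

Lemma decr_log_concave_integral (R : realType) (f : R -> R) (D : set R) :
  decr_log_concave f -> measurable D -> D `<=` `[0, +oo[ ->
  exists2 I : R, 0 <= I & (\int[mu]_(t in D) (f t)%:E = I%:E)%E.
Proof.
move=> df mD D0; have intf := decr_log_concave_integrable df mD D0.
exists (fine (\int[mu]_(t in D) (f t)%:E)); last first.
  by rewrite fineK // integrable_fin_num.
rewrite fine_ge0 // integral_ge0 // => t /D0 /=.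
by rewrite in_itv /= andbT lee_fin; case: df => f0 _ _ _; exact: f0.
Qed.

Lemma subset_itvcc_ge0 (R : realType) (u v : R) :
  0 <= u -> `[u, v] `<=` `[0, +oo[.
Proof.
by move=> u0 t /=; rewrite !in_itv /= andbT => /andP[/(le_trans u0)].
Qed.

Lemma subset_itvcy_ge0 (R : realType) (u : R) :
  0 <= u -> `[u, +oo[ `<=` `[0, +oo[.
Proof. by move=> u0 t /=; rewrite !in_itv /= !andbT; exact: le_trans. Qed.

Lemma integral_half_line_split (R : realType) (F : R -> R) (h : R) :
  0 <= h -> measurable_fun (`[0, +oo[ : set R) F ->
  (forall t, 0 <= t -> 0 <= F t) ->
  (integral_half_line F =
   integral_to F h + \int[mu]_(t in `[h, +oo[) (F t)%:E)%E.
Proof.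
move=> h0 mF F0; rewrite /integral_half_line /integral_to.
have mE (D : set R) : measurable D -> D `<=` `[0, +oo[ ->
    measurable_fun D (EFin \o F).
  move=> mD D0; apply/measurable_EFinP; exact: measurable_funS mF.
rewrite -integral_itv_obnd_cbnd; last first.
  apply: mE => // t /=; rewrite !in_itv /= !andbT => /ltW; exact: le_trans.
have -> : `[0, +oo[%classic = `[0, h]%classic `|` `]h, +oo[%classic.
  apply/seteqP; split=> t /=; rewrite !in_itv /= ?andbT.
    by move=> ->; have [] := leP t h; [left|right].
  by move=> [/andP[]//|/ltW]; exact: le_trans.
rewrite ge0_integral_setU //.
- apply: mE; first exact: measurableU.
  move=> t /=; rewrite !in_itv /= ?andbT.
  by move=> [/andP[]//|/ltW]; exact: le_trans.
- move=> t /=; rewrite !in_itv /= ?andbT lee_fin => H; apply: F0.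
  by move: H => [/andP[]//|/ltW]; exact: le_trans.
- apply/disj_set2P; rewrite -subset0 => t /= []; rewrite !in_itv /= ?andbT.
  by move=> /andP[_ th] /lt_geF; rewrite th.
Qed.

Lemma integrable_expfun (R : realType) (c a u v : R) :
  mu.-integrable `[u, v] (EFin \o expfun c a).
Proof.
apply: continuous_compact_integrable; first exact: segment_compact.
by apply: continuous_subspaceT => t; exact: continuous_expfun.
Qed.

Lemma lebesgue_measure_itvco_neq0 (R : realType) (h : R) :
  0 < h -> mu (`[0, h[%classic : set R) <> 0%E.
Proof.
by move=> h0; rewrite lebesgue_measure_itv /= lte_fin h0 -EFinB subr0;
  case=> h00; rewrite h00 ltxx in h0.
Qed.

(** If f exceeded the exponential at some t > h, then by log-concavity and
    f h = expfun c a h it would be strictly below it on [0, h[, against the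
    equality of the integrals over [0, h]. *)
Lemma tail_le_expfun (R : realType) (f : R -> R) (c a h : R) :
  decr_log_concave f -> 0 < c -> 0 < h -> f h = expfun c a h ->
  integral_to f h = integral_to (expfun c a) h ->
  forall t, h <= t -> f t <= expfun c a t.
Proof.
move=> df c0 h0 fh intE t; rewrite le_eqVlt => /predU1P[<-|ht].
  by rewrite fh.
rewrite leNgt; apply/negP => gft.
(* Above the exponential at t, f is strictly below it on all of [0, h[. *)
have lt_head s : 0 <= s -> s < h -> f s < expfun c a s.
  move=> s0 sh; rewrite ltNge; apply/negP => gs.
  case: df => _ _ _ lcf.
  by have := log_concave_crossing_lt lcf c0 s0 sh ht gs gft; rewrite fh ltxx.
apply: (lebesgue_measure_itvco_neq0 h0).
apply: (@measure0_lt_of_eq_integral _ _ R (@lebesgue_measure R)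
          `[0, h]%classic _ f (expfun c a)) => //.
- move=> s /=; rewrite !in_itv /= => /andP[-> /ltW ->] //.
- exact: decr_log_concave_integrable df _ (@subset_itvcc_ge0 _ _ _ (lexx 0)).
- exact: integrable_expfun.
- move=> s /=; rewrite !in_itv /= => /andP[s0].
  by rewrite le_eqVlt => /predU1P[->|/(lt_head _ s0)/ltW//]; rewrite fh.
- by move=> s /=; rewrite !in_itv /= => /andP[]; exact: lt_head.
Qed.

(** The integral of a decreasing f over [0, h] is at least f h * h; equality
    forces f = f h almost everywhere there, hence on ]0, h] by monotonicity.
    The value at 0 may be larger. *)
Lemma le_head_of_integral_eq (R : realType) (f : R -> R) (h : R) :
  decr_log_concave f -> 0 < h -> integral_to f h = (f h * h)%:E ->
  forall t, 0 < t -> f t <= f h.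
Proof.
move=> df h0 intE t t0; have [_ decf _ _] := df.
have [th|ht] := ltP t h; last by apply: decf => //; exact: ltW.
rewrite leNgt; apply/negP => ft.
apply: (lebesgue_measure_itvco_neq0 t0).
apply: (@measure0_lt_of_eq_integral _ _ R (@lebesgue_measure R)
          `[0, h]%classic _ (fun=> f h) f) => //.
- move=> s /=; rewrite !in_itv /= => /andP[-> /ltW st] /=.
  exact: le_trans st (ltW th).
- apply: continuous_compact_integrable; first exact: segment_compact.
  by apply: continuous_subspaceT => s; exact: cvg_cst.
- exact: decr_log_concave_integrable df _ (@subset_itvcc_ge0 _ _ _ (lexx 0)).
- by move=> s /=; rewrite !in_itv /= => /andP[s0 sh]; exact: decf.
- move=> s /=; rewrite !in_itv /= => /andP[s0 st].
  by apply: lt_le_trans ft _; apply: decf => //; exact: ltW.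
- rewrite -[RHS]/(integral_to f h) intE integral_cst //=.
  by rewrite lebesgue_measure_itv /= lte_fin h0 -EFinB subr0 -EFinM.
Qed.

(** On [0, h] the exponential starts above f and ends below it, meeting it at
    h. Being equal in integral and steeper, it has the larger power integral:
    with M the height of f at the crossing, convexity gives
    f^p + l g <= g^p + l f for l = p M^(p-1). *)
Lemma head_power_le (R : realType) (p : R) (f : R -> R) (c a h : R) :
  1 < p -> decr_log_concave f -> 0 < c -> 0 < h -> f h = expfun c a h ->
  integral_to f h = integral_to (expfun c a) h ->
  (integral_to (fun t => (f t `^ p)%R) h
     <= integral_to (fun t => (expfun c a t `^ p)%R) h)%E.
Proof.
move=> p1 df c0 h0 fh intE; have [f0 decf _ lcf] := df.
have sub := @subset_itvcc_ge0 R 0 h (lexx 0).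
have mI : measurable (`[0, h]%classic : set R) by [].
have [I I0 IE] := decr_log_concave_integral df mI sub.
(* sup S separates the values of f before the crossing from those after it;
   it is the number M of the multiplier. *)
pose S := [set f t | t in [set t | 0 <= t <= h /\ expfun c a t <= f t]].
have Sh : S (f h) by exists h => //=; split; rewrite ?fh // (ltW h0) lexx.
have supS t : 0 <= t <= h -> expfun c a t <= f t -> f t <= sup S.
  move=> th gf; apply: ub_le_sup; last by exists t.
  by exists (f 0) => _ [s [/andP[s0 _] _] <-]; apply: decf.
have leS t : 0 <= t <= h -> f t < expfun c a t -> sup S <= f t.
  move=> /andP[t0 th] fg; apply: ge_sup; first by exists (f h).
  move=> _ [s [/andP[s0 sh] gs] <-]; apply: decf => //.
  rewrite leNgt; apply/negP => st; move: fg; apply/negP; rewrite -leNgt.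
  by apply: (log_concave_crossing_le lcf c0 s0 (ltW st) th gs); rewrite fh.
have S0 : 0 <= sup S.
  by apply: (le_trans (f0 h (ltW h0))); apply: supS; rewrite ?fh ?lexx ?ltW.
apply: (@integral_exchange_le _ _ R (@lebesgue_measure R) _
          f (expfun c a) _ _ (p * sup S `^ (p - 1)) I) => //.
- by rewrite mulr_ge0 ?powR_ge0 //; lra.
- exact: decr_log_concave_measurable.
- exact: measurable_expfun.
- exact: decr_log_concave_powR_measurable.
- by apply: measurable_fun_powR; exact: measurable_expfun.
- move=> t /sub /=; rewrite in_itv /= andbT => t0.
  by rewrite f0 // (ltW (expfun_gt0 _ _ _)) // !powR_ge0.
- move=> t /=; rewrite in_itv /= => th; have /andP[t0 _] := th.
  have := powR_tangent p1 (ltW (expfun_gt0 a t c0)) (f0 t t0).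
  (* f t - sup S and expfun c a t - f t are never of opposite signs. *)
  suff : p * sup S `^ (p - 1) * (expfun c a t - f t)
          <= p * f t `^ (p - 1) * (expfun c a t - f t) by lra.
  have q0 : 0 <= p - 1 by lra.
  have p0 : 0 < p by lra.
  have [fg|gf] := ltP (f t) (expfun c a t).
    rewrite ler_wpM2r ?subr_ge0 ?(ltW fg) // ler_pM2l //.
    by rewrite ge0_ler_powR ?nnegrE ?leS ?f0.
  rewrite ler_wnM2r ?subr_le0 // ler_pM2l //.
  by rewrite ge0_ler_powR ?nnegrE ?supS ?f0.
- by rewrite -IE.
Qed.

(** Past h the exponential g dominates f, so cutting it at height m moves the
    mass of f to where g is largest. With l = m^(p-1) the inequality
    f (f^(p-1) - l) <= g (g^(p-1) - l) holds where g >= m, and its left-hand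
    side is nonpositive where g < m. *)
Lemma tail_power_le (R : realType) (p : R) (f : R -> R) (c a h m : R) :
  1 < p -> decr_log_concave f -> 0 < c -> 0 < a -> 0 < h ->
  (forall t, h <= t -> f t <= expfun c a t) -> 0 <= m -> m <= expfun c a h ->
  (\int[mu]_(t in `[h, +oo[) (f t)%:E = ((expfun c a h - m) / a)%:E)%E ->
  (\int[mu]_(t in `[h, +oo[) (f t `^ p)%:E
     <= \int[mu]_(t in `[h, +oo[) (trunc_expfun m c a t `^ p)%:E)%E.
Proof.
move=> p1 df c0 a0 h0 fg m0 mh intE; have [f0 _ _ _] := df.
have sub := subset_itvcy_ge0 (ltW h0).
have q0 : 0 < p - 1 by lra.
apply: (@integral_exchange_le _ _ R (@lebesgue_measure R) _
          f (trunc_expfun m c a) _ _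
          (m `^ (p - 1)) ((expfun c a h - m) / a)) => //.
- exact: powR_ge0.
- exact: decr_log_concave_measurable.
- exact: measurable_trunc_expfun.
- exact: decr_log_concave_powR_measurable.
- by apply: measurable_fun_powR; exact: measurable_trunc_expfun.
- move=> t /sub /=; rewrite in_itv /= andbT => t0.
  rewrite f0 // !powR_ge0 /trunc_expfun.
  by case: ifP => // _; rewrite ltW // expfun_gt0.
- move=> t /=; rewrite in_itv /= andbT => ht.
  have t0 : 0 <= t := le_trans (ltW h0) ht.
  have := fg t ht; rewrite /trunc_expfun; have := f0 t t0.
  set u := f t; set g := expfun c a t => u0 ug.
  have g0 : 0 <= g := le_trans u0 ug.
  rewrite -(@mulr_powRB1 _ u p) //; last lra.
  have mono := ge0_ler_powR (ltW q0).
  case: ifP => [mg|/negbT]; last first.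
    rewrite -ltNge => gm; rewrite powR0 ?mulr0 ?addr0 ?add0r ?gt_eqF //;
      last lra.
    rewrite mulrC ler_wpM2r //; apply: mono; rewrite ?nnegrE //.
    exact: le_trans ug (ltW gm).
  rewrite -(@mulr_powRB1 _ g p) //; last lra.
  have : m `^ (p - 1) <= g `^ (p - 1) by apply: mono.
  have : u `^ (p - 1) <= g `^ (p - 1) by apply: mono.
  move: (powR_ge0 u (p - 1)) (powR_ge0 m (p - 1)).
  set U := u `^ _; set G := g `^ _; set M := m `^ _ => U0 M0 UG MG.
  (* The claim is u (U - M) <= g (G - M); its right-hand side is
     nonnegative. *)
  have [UM|MU] := leP U M.
    have : u * U <= u * M by rewrite ler_wpM2l.
    have : g * M <= g * G by rewrite ler_wpM2l.
    lra.
  have : u * (U - M) <= g * (G - M) by apply: ler_pM => //; lra.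
  lra.
- exact: integral_trunc_expfun.
Qed.

(** The reduction to truncated exponentials: the exponential c exp(- a t), cut
    where it has lost the proportion x of its height, has the integrals of f
    over [0, h] and over the half-line, and its power p has the larger
    integral. The number y is the proportion of height lost at h. *)
Lemma truncated_exponential_majorant (R : realType) (p : R) (f : R -> R)
    (h I : R) :
  1 < p -> decr_log_concave f -> 0 < h -> 0 < f h ->
  integral_to f h = I%:E -> f h * h < I ->
  exists a c x y : R, [/\ 0 < a, 0 < c, 0 < y < 1, 0 < x <= 1 &
    [/\ - ln (1 - y) = a * h, integral_to f h = (c * y / a)%:E,
        integral_half_line f = (c * x / a)%:E &
        (integral_half_line (fun t => (f t `^ p)%R)
          <= (c `^ p * (1 - (1 - x) `^ p) / (a * p))%:E)%E]].
Proof.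
move=> p1 df h0 b0 IE bI; have [f0 decf _ lcf] := df.
have r1 : 1 < I / (f h * h) by rewrite ltr_pdivlMr ?mul1r ?mulr_gt0.
(* z = a h is the exponent for which the exponential through (h, f h) has
   integral I over [0, h]. *)
have [z z0 ez] := expR_secant_surj r1.
pose a := z / h; pose c := f h * expR z.
have a0 : 0 < a by rewrite divr_gt0.
have c0 : 0 < c by rewrite mulr_gt0 ?expR_gt0.
have ah : a * h = z by rewrite /a divfK // gt_eqF.
have gh : expfun c a h = f h.
  by rewrite /expfun ah /c -mulrA -expRD subrr expR0 mulr1.
have g0 : expfun c a 0 = c by rewrite /expfun mulr0 oppr0 expR0 mulr1.
have cb : c - f h = a * I.
  by rewrite /c ez /a; field; rewrite !gt_eqF.
have bc : f h < c by rewrite -subr_gt0 cb mulr_gt0 // (lt_trans _ bI) ?mulr_gt0.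
have an0 : a != 0 by rewrite gt_eqF.
have intg : integral_to (expfun c a) h = I%:E.
  rewrite /integral_to integral_expfun ?ltW // gh g0 cb.
  by rewrite mulrAC mulfV // mul1r.
have intE : integral_to f h = integral_to (expfun c a) h by rewrite IE intg.
have fg := tail_le_expfun df c0 h0 (esym gh) intE.
have sub := subset_itvcy_ge0 (ltW h0).
have mI : measurable (`[h, +oo[%classic : set R) by [].
have [B B0 BE] := decr_log_concave_integral df mI sub.
(* m is the height at which the exponential must be cut for the tails to
   have the same integral B. *)
pose m := f h - a * B.
have m0 : 0 <= m.
  rewrite subr_ge0 mulrC -ler_pdivlMr // -lee_fin -BE -gh.
  rewrite -integral_expfuny ?(ltW c0) //.
  apply: (@ge0_le_integral _ _ R (@lebesgue_measure R) _ _
            (EFin \o f) (EFin \o expfun c a)) => //.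
  - by move=> t /sub /=; rewrite in_itv /= andbT lee_fin => /f0.
  - exact: measurable_int (decr_log_concave_integrable df mI sub).
  - by apply/measurable_EFinP; exact: measurable_expfun.
  - by move=> t /=; rewrite in_itv /= andbT lee_fin => /fg.
have mb : m <= f h by rewrite gerBl mulr_ge0 // ltW.
have Bm : B = (expfun c a h - m) / a.
  by rewrite gh /m opprB addrCA subrr addr0 mulrAC mulfV ?mul1r.
have p0 : 0 < p by lra.
exists a, c, (1 - m / c), (1 - f h / c); split => //.
- by rewrite subr_gt0 ltr_pdivrMr ?mul1r // bc gtrBl divr_gt0.
- rewrite subr_gt0 ltr_pdivrMr ?mul1r // (le_lt_trans mb) //=.
  by rewrite gerBl divr_ge0 // ltW.
have mT : measurable (`[0, +oo[%classic : set R) by [].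
have measf := decr_log_concave_measurable df mT (@subset_refl _ _).
split.
- rewrite subKr /c invfM mulrA divff ?gt_eqF // mul1r -expRN expRK opprK ah //.
- by rewrite IE; congr _%:E; apply: (mulIf an0); rewrite divfK //
    (mulrC I) -cb mulrBr mulr1 mulrC divfK // gt_eqF.
- rewrite (integral_half_line_split (ltW h0) measf f0) IE BE -EFinD.
  congr _%:E; rewrite Bm gh; apply: (mulIf an0); rewrite mulrDl !divfK //.
  rewrite (mulrC I) -cb mulrBr mulr1 (mulrC c (_ / _)) divfK ?gt_eqF //; lra.
rewrite (integral_half_line_split (ltW h0)); last 2 first.
- by apply: measurable_fun_powR.
- by move=> t _; exact: powR_ge0.
have head := head_power_le p1 df c0 h0 (esym gh) intE.
have mh : m <= expfun c a h by rewrite gh.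
have tail : (\int[mu]_(t in `[h, +oo[) (f t `^ p)%:E
     <= \int[mu]_(t in `[h, +oo[) (trunc_expfun m c a t `^ p)%:E)%E.
  by apply: tail_power_le => //; rewrite BE Bm.
apply: (le_trans (leeD head tail)).
under eq_integral do rewrite trunc_expfun_powR //.
rewrite integral_trunc_expfun ?powR_gt0 ?powR_ge0 ?(mulr_gt0 a0 p0) //;
  last first.
  by rewrite -expfun_powR // ge0_ler_powR ?nnegrE ?(ltW p0) //
    (ltW (expfun_gt0 _ _ _)).
rewrite /integral_to; under eq_integral do rewrite expfun_powR //.
rewrite integral_expfun ?(ltW h0) ?(gt_eqF (mulr_gt0 a0 p0)) //.
rewrite -EFinD lee_fin.
rewrite -!expfun_powR // g0.
have -> : 1 - (1 - m / c) = m / c by ring.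
rewrite mulrBr mulr1 -powRM ?divr_ge0 ?(ltW c0) // (mulrC c) divfK ?gt_eqF //.
by rewrite -mulrDl addrA subrK.
Qed.

(** * The power mean inequality *)

(** Pointwise f^p <= M^(p-1) f, except perhaps at 0. *)
Lemma integral_powR_le_of_bounded (R : realType) (p M : R) (f : R -> R) :
  1 < p -> decr_log_concave f -> (forall t, 0 < t -> f t <= M) -> 0 <= M ->
  (integral_half_line (fun t => (f t `^ p)%R)
    <= (M `^ (p - 1))%:E * integral_half_line f)%E.
Proof.
move=> p1 df fM M0; have [f0 _ _ _] := df.
have sub : `]0, +oo[ `<=` (`[0, +oo[ : set R).
  by move=> t /=; rewrite !in_itv /= !andbT => /ltW.
have mf := decr_log_concave_measurable df (measurable_itv _) sub.
have mfp := decr_log_concave_powR_measurable p df (measurable_itv _) sub.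
rewrite /integral_half_line -!integral_itv_obnd_cbnd;
  [|exact/measurable_EFinP..].
rewrite -ge0_integralZl //; last 3 first.
- exact/measurable_EFinP.
- by move=> t /sub /=; rewrite in_itv /= andbT lee_fin; exact: f0.
- by rewrite lee_fin powR_ge0.
apply: (@ge0_le_integral _ _ R (@lebesgue_measure R)) => //.
- by move=> t _; rewrite lee_fin powR_ge0.
- exact/measurable_EFinP.
- by apply: measurable_funeM; exact/measurable_EFinP.
- move=> t /=; rewrite in_itv /= andbT => t0; rewrite -EFinM lee_fin.
  rewrite -(@mulr_powRB1 _ (f t) p) ?f0 ?(ltW t0) //; last lra.
  rewrite mulrC ler_wpM2r ?f0 ?(ltW t0) //.
  by rewrite ge0_ler_powR ?nnegrE ?fM ?f0 ?(ltW t0) //; lra.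
Qed.

(** After the reduction the integrals are c y/a over [0, h] and c x/a over the
    half-line, so the hypothesis says y <= theta x; the mean over [0, h] is
    c / k y, and the claim becomes theta_const_ratio. *)
Lemma admissible_theta_const (R : realType) (p : R) :
  1 < p -> admissible p (theta_const p).
Proof.
move=> p1 f h df h0 le_theta; have [f0 decf _ _] := df.
have mI : measurable (`[0, h]%classic : set R) by [].
have mT : measurable (`[0, +oo[%classic : set R) by [].
have subI := @subset_itvcc_ge0 R 0 h (lexx 0).
have [I I0 IE] := decr_log_concave_integral df mI subI.
have b0 : 0 <= f h by apply: f0; exact: ltW.
have hn0 : h != 0 by rewrite gt_eqF.
have bI : f h * h <= I.
  rewrite -lee_fin -IE EFinM.
  have <- : (\int[mu]_(t in `[0%R, h]) (f h)%:E = (f h)%:E * h%:E)%E.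
    by rewrite integral_cst //= lebesgue_measure_itv /= lte_fin h0 sube0.
  apply: (@ge0_le_integral _ _ R (@lebesgue_measure R)) => //.
  - by apply/measurable_EFinP; exact: decr_log_concave_measurable.
  - move=> t /=; rewrite in_itv /= lee_fin => /andP[t0 th]; exact: decf.
have {}IE : integral_to f h = I%:E := IE.
have meanE : mean_to f h = (I / h)%:E by rewrite /mean_to IE -EFinM mulrC.
rewrite /power_mean_bound meanE poweR_EFin.
(* If f h is the mean of f on [0, h], it bounds f on ]0, +oo[, and the
   inequality holds whatever the ratio of the integrals. *)
have [constf|neqbI] := eqVneq (f h * h) I.
  apply: integral_powR_le_of_bounded => //; last by rewrite divr_ge0 ?(ltW h0).
  rewrite -constf mulfK //; apply: le_head_of_integral_eq => //.
  by rewrite constf.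
have {}bI' : f h * h < I by rewrite lt_neqAle neqbI.
have theta1 := theta_const_lt1 p1; have theta0 := theta_const_gt0 p1.
have Ipos : 0 < I by apply: le_lt_trans bI'; rewrite mulr_ge0 // ltW.
(* If f h = 0, all the mass of f lies in [0, h], against theta < 1. *)
have bpos : 0 < f h.
  rewrite lt_neqAle b0 andbT eq_sym; apply/eqP => fh0.
  have tail0 : (\int[mu]_(t in `[h, +oo[) (f t)%:E = 0)%E.
    rewrite integral0_eq // => t /=; rewrite in_itv /= andbT => ht.
    congr _%:E; apply/eqP; rewrite eq_le f0 ?(le_trans (ltW h0)) //.
    by rewrite -[X in _ <= X]fh0 decf // ltW.
  move: le_theta.
  have mf := decr_log_concave_measurable df mT (@subset_refl _ _).
  rewrite (integral_half_line_split (ltW h0) mf f0) tail0 adde0 IE.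
  rewrite -EFinM lee_fin leNgt => /negP; apply.
  by rewrite gtr_pMl.
have [a [c [x [y [a0 c0 /andP[y0 y1] /andP[x0 x1] [yE fIE fJE maj]]]]]] :=
  truncated_exponential_majorant p1 df h0 bpos IE bI'.
have an0 : a != 0 by rewrite gt_eqF.
have yx : y <= theta_const p * x.
  move: le_theta; rewrite fIE fJE -EFinM lee_fin.
  by rewrite mulrA ler_pM2r ?invr_gt0 // mulrCA ler_pM2l.
have key := theta_const_ratio p1 x0 x1 y0 yx.
have k0 := k_gt0 y0 y1.
have meank : I / h = c / k y.
  have -> : I = c * y / a by case: (etrans (esym IE) fIE).
  have -> : k y = a * h / y by rewrite -yE /k mulNr.
  by field; rewrite hn0 an0 gt_eqF.
apply: (le_trans maj); rewrite fJE -EFinM lee_fin meank.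
rewrite powRM ?(ltW c0) ?invr_ge0 ?(ltW k0) //.
have -> : (k y)^-1 `^ (p - 1) = (k y `^ (p - 1))^-1.
  by rewrite -powR_inv1 ?(ltW k0) // powRAC powR_inv1 ?powR_ge0.
rewrite -(@mulr_powRB1 _ c p) ?(ltW c0) //; last lra.
have kq0 : 0 < k y `^ (p - 1) by rewrite powR_gt0.
have cq0 : 0 < c `^ (p - 1) by rewrite powR_gt0.
move: key kq0 cq0; set K := k y `^ _; set C := c `^ _; set X := (1 - x) `^ p.
move=> key kq0 cq0; have p0 : 0 < p by lra.
have -> : c * C * (1 - X) / (a * p) = c * C / (a * p * K) * (K * (1 - X)).
  by field; rewrite !gt_eqF.
have -> : C / K * (c * x / a) = c * C / (a * p * K) * (p * x).
  by field; rewrite !gt_eqF.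
by rewrite ler_pM2l // divr_gt0 ?mulr_gt0.
Qed.

Lemma admissible1 (R : realType) (theta : R) : admissible 1 theta.
Proof.
move=> f h [f0 _ _ _] h0 _; rewrite /power_mean_bound subrr poweRe0 mul1e.
rewrite le_eqVlt; apply/orP; left; apply/eqP; apply: eq_integral => t.
by rewrite inE /= in_itv /= andbT => /f0 ?; rewrite powRr1.
Qed.

Lemma integral_indic_half_line (R : realType) (c d : R) : 0 < d ->
  integral_half_line (fun t => c * \1_(`[0, d]%classic : set R) t)
    = (c * d)%:E.
Proof.
move=> d0; rewrite /integral_half_line.
transitivity (\int[mu]_(t in `[0%R, +oo[) ((cst c%:E) \_ `[0%R, d]) t)%E.
  apply: eq_integral => t _; rewrite /patch indicE.
  by case: ifP; rewrite ?mulr1 ?mulr0.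
rewrite -integral_mkcondr.
have -> : `[0, +oo[%classic `&` `[0, d]%classic = `[0, d]%classic :> set R.
  by apply: setIidr; exact: subset_itvcc_ge0.
by rewrite integral_cst //= lebesgue_measure_itv /= lte_fin d0 sube0 EFinM.
Qed.

Lemma power_mean_bound_indic (R : realType) (p c d h : R) : 1 <= p ->
  0 <= c -> 0 < h -> h <= d ->
  let f := fun t : R => c * \1_(`[0, d] : set R) t in
  integral_half_line (fun t => f t `^ p) = power_mean_bound p f h.
Proof.
move=> p1 c0 h0 hd /=; have d0 := lt_le_trans h0 hd.
have p0 : 0 < p := lt_le_trans ltr01 p1.
have -> : (fun t => (c * \1_(`[0, d]%classic : set R) t) `^ p)
    = (fun t => c `^ p * \1_(`[0, d]%classic : set R) t).
  apply/funext => t; rewrite indicE.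
  by case: (_ \in _); rewrite /= ?mulr1 // !mulr0 powR0 // gt_eqF.
rewrite /power_mean_bound !integral_indic_half_line //.
have -> : mean_to (fun t => c * \1_(`[0, d]%classic : set R) t) h = c%:E.
  rewrite /mean_to /integral_to.
  have -> : (\int[mu]_(t in `[0%R, h]) (c * \1_(`[0, d]%classic : set R) t)%:E
      = c%:E * h%:E)%E.
    transitivity (\int[mu]_(t in `[0%R, h]) c%:E)%E.
      apply: eq_integral => t; rewrite inE /= in_itv /= => /andP[t0 th].
      by rewrite indicE mem_set ?mulr1 //= in_itv /= t0 (le_trans th).
    by rewrite integral_cst //= lebesgue_measure_itv /= lte_fin h0 sube0.
  by rewrite -!EFinM mulrCA mulVf ?mulr1 // gt_eqF.
by rewrite poweR_EFin -EFinM mulrA (mulrC _ c) mulr_powRB1.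
Qed.

Theorem proposition1p4 (R : realType) (p : R) (p_ge1 : 1 <= p) :
  [/\ exists2 theta : R, 0 < theta & admissible p theta,
      forall c d h : R, 0 <= c -> 0 < h -> h <= d ->
        let f := fun t : R => c * \1_(`[0, d] : set R) t in
        integral_half_line (fun t => f t `^ p) = power_mean_bound p f h
    & 1 < p -> 0 < theta_const p /\ admissible p (theta_const p)].
Proof.
have sharp : 1 < p -> 0 < theta_const p /\ admissible p (theta_const p).
  by move=> p1; split; [exact: theta_const_gt0|exact: admissible_theta_const].
split=> //; last by move=> c d h; exact: power_mean_bound_indic.
move: p_ge1; rewrite le_eqVlt => /predU1P[<-|/sharp[t0 adm]].
  by exists 1; [exact: ltr01|exact: admissible1].
by exists (theta_const p).
Qed.
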